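(* Let $D_1,D_2$ be bivariate extreme-value copulas with Pickands dependence functions $A_1$ and $A_2$, respectively. Let $(U,V)$ and $(U',V')$ be bivariate random vectors with distribution functions $F_{U,V}=D_1$ and $F_{U',V'}=D_2$. Then the following statements are equivalent: (i) $A_1(t)\geq A_2(t)$ for all $t\in(0,1)$; (ii) $D_1\leq_{lo} D_2$; (iii) $D_1\leq_{\partial S} D_2$; (iv) $(V|U)\leq_S (V'|U')$; (v) $(U|V)\leq_S (U'|V')$.
   Context: A bivariate copula is a function $C:[0,1]^2\to[0,1]$ that is grounded, $2$-increasing and has uniform marginals; a random vector with distribution function $C$ takes values in $[0,1]^2$ and has marginals uniform on $(0,1)$. $\partial_i$ denotes the partial derivative with respect to the $i$th component (defined almost everywhere in that component). Extreme-value copula: let $A:[0,1]\to[1/2,1]$ be convex with $\max\{t,1-t\}\leq A(t)\leq 1$ for all $t\in[0,1]$. A bivariate copula $C=C_A$ is an extreme-value copula with Pickands dependence function $A$ if $C_A(u,v)=\exp\left(\ln(uv)\,A\left(\frac{\ln v}{\ln u+\ln v}\right)\right)$ for all $(u,v)\in(0,1)^2$. Lower orthant order: $D\leq_{lo}E$ means $D(u,v)\leq E(u,v)$ for all $(u,v)\in[0,1]^2$. Schur order for functions: for an integrable $h:(0,1)\to\mathbb{R}$, let $h^*$ denote its decreasing rearrangement, i.e. the essentially unique decreasing function with $\lambda(h^*\geq w)=\lambda(h\geq w)$ for all $w\in\mathbb{R}$, where $\lambda$ is Lebesgue measure on $(0,1)$. For integrable $f,g:(0,1)\to\mathbb{R}$,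 write $f\prec_S g$ if $\int_0^x f^*(t)\,dt\leq\int_0^x g^*(t)\,dt$ for all $x\in(0,1)$ and $\int_0^1 f^*(t)\,dt=\int_0^1 g^*(t)\,dt$. Schur order for copula derivatives: $D\leq_{\partial_1 S}E$ if $\partial_1 D(\cdot,v)\prec_S\partial_1E(\cdot,v)$ for all $v\in(0,1)$; $D\leq_{\partial_2 S}E$ if $\partial_2 D(v,\cdot)\prec_S\partial_2E(v,\cdot)$ for all $v\in(0,1)$; $D\leq_{\partial S}E$ if both $D\leq_{\partial_1S}E$ and $D\leq_{\partial_2S}E$. Schur order for conditional distributions: let $q_X(t)=\inf\{x\in\mathbb{R}\mid F_X(x)\geq t\}$, $t\in(0,1)$, be the quantile function of $X$. For bivariate random vectors $(X_1,X_2)$, $(Y_1,Y_2)$ with $X_2$ and $Y_2$ equal in distribution, $(X_2|X_1)\leq_S(Y_2|Y_1)$ means that $P(X_2\leq y\mid X_1=q_{X_1}(\cdot))\prec_S P(Y_2\leq y\mid Y_1=q_{Y_1}(\cdot))$ (as functions on $(0,1)$) for all $y\in\mathbb{R}$. *)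

(* Defs.v *)
From mathcomp Require Import all_boot all_order all_algebra.
From mathcomp Require Import all_classical all_reals all_analysis.

Set Implicit Arguments.
Unset Strict Implicit.
Unset Printing Implicit Defensive.

Import Order.TTheory GRing.Theory Num.Theory.
Import numFieldNormedType.Exports.

Local Open Scope classical_set_scope.
Local Open Scope ring_scope.

Section copulas.
Context {R : realType}.

(* Only the values on [0,1]^2 are relevant. *)
Definition is_copula (C : R -> R -> R) : Prop :=
  [/\ {in `[0, 1] &, forall u v, 0 <= C u v <= 1},
      {in `[0, 1], forall u, C u 0 = 0 /\ C 0 u = 0},
      {in `[0, 1], forall u, C u 1 = u /\ C 1 u = u}
    & forall u1 u2 v1 v2, 0 <= u1 -> u1 <= u2 -> u2 <= 1 ->
        0 <= v1 -> v1 <= v2 -> v2 <= 1 ->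
        0 <= C u2 v2 - C u2 v1 - C u1 v2 + C u1 v1].

(* The lower bound max(t, 1 - t) already forces A to take values in [1/2,1]. *)
Definition is_pickands (A : R -> R) : Prop :=
  convex_function (`[0, 1]%classic : set R) A /\
  {in `[0, 1], forall t, Num.max t (1 - t) <= A t <= 1}.

Definition is_ev_copula (A : R -> R) (C : R -> R -> R) : Prop :=
  [/\ is_copula C, is_pickands A
    & {in `]0, 1[ &, forall u v,
        C u v = expR (ln (u * v) * A (ln v / (ln u + ln v)))}].

Definition le_lo (D E : R -> R -> R) : Prop :=
  {in `[0, 1] &, forall u v, D u v <= E u v}.

End copulas.

Section schur_order.
Context {R : realType}.
Implicit Types f g h : R -> R.

(* Functions on (0,1) are total functions on R whose values outside (0,1) are
   never used. *)
Definition is_decreasing_rearrangement h hs : Prop :=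
  {in `]0, 1[ &, nonincreasing_fun hs} /\
  forall w : R, lebesgue_measure [set t : R | 0 < t < 1 /\ w <= hs t] =
                lebesgue_measure [set t : R | 0 < t < 1 /\ w <= h t].

(* The rearrangement is unique up to null sets, so the choice made by [get]
   does not affect the integrals below. *)
Definition decreasing_rearrangement h : R -> R :=
  get [set hs | is_decreasing_rearrangement h hs].

(* Integrability, the domain of the relation, is part of the definition. *)
Definition schur_le f g : Prop :=
  [/\ lebesgue_measure.-integrable (`]0, 1[ : set R) (EFin \o f),
      lebesgue_measure.-integrable (`]0, 1[ : set R) (EFin \o g),
      {in `]0, 1[, forall x : R,
        (\int[lebesgue_measure]_(t in `]0%R, x[)
           (decreasing_rearrangement f t)%:E <=
         \int[lebesgue_measure]_(t in `]0%R, x[)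
           (decreasing_rearrangement g t)%:E)%E}
    & (\int[lebesgue_measure]_(t in `]0%R, 1%R[)
         (decreasing_rearrangement f t)%:E =
       \int[lebesgue_measure]_(t in `]0%R, 1%R[)
         (decreasing_rearrangement g t)%:E)%E].

(* [derive1] is total; where the derivative does not exist (a null set in the
   differentiation variable) its value is irrelevant. *)
Definition le_d1S (D E : R -> R -> R) : Prop :=
  {in `]0, 1[, forall v : R,
    schur_le (derive1 (fun u => D u v)) (derive1 (fun u => E u v))}.

Definition le_d2S (D E : R -> R -> R) : Prop :=
  {in `]0, 1[, forall v : R,
    schur_le (derive1 (D v)) (derive1 (E v))}.

Definition le_dS (D E : R -> R -> R) : Prop := le_d1S D E /\ le_d2S D E.

End schur_order.

Section random_vectors.
Context {R : realType} d (T : measurableType d) (P : probability T R).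
Implicit Types X Y : {RV P >-> R}.

Definition joint_cdf X Y (x y : R) : \bar R :=
  P (X @^-1` `]-oo, x] `&` Y @^-1` `]-oo, y]).

(* Since C is a copula, the values on [0,1]^2 determine the joint distribution
   function everywhere (and (X, Y) lies in [0,1]^2 almost surely). *)
Definition has_joint_cdf X Y (C : R -> R -> R) : Prop :=
  {in `[0, 1] &, forall u v : R, joint_cdf X Y u v = (C u v)%:E}.

Definition quantile X (t : R) : R := inf [set x : R | (t%:E <= cdf X x)%E].

(* [g] is a version of x |-> P(X2 <= y | X1 = x): it integrates over every
   Borel set B, against the law of X1, to P(X1 \in B, X2 <= y). *)
Definition is_cond_cdf (X2 X1 : {RV P >-> R}) (y : R) (g : R -> R) : Prop :=
  (distribution P X1).-integrable setT (EFin \o g) /\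
  forall B : set R, measurable B ->
    (\int[distribution P X1]_(x in B) (g x)%:E =
     P (X1 @^-1` B `&` X2 @^-1` `]-oo, y]))%E.

(* Two versions agree almost surely for the law of X1, which is the image of
   Lebesgue measure on (0,1) by the quantile function of X1. *)
Definition cond_cdf (X2 X1 : {RV P >-> R}) (y : R) : R -> R :=
  get [set g | is_cond_cdf X2 X1 y g].

End random_vectors.

Section conditional_schur_order.
Context {R : realType} d d' (T : measurableType d) (T' : measurableType d').
Context (P : probability T R) (P' : probability T' R).

Definition eq_in_distribution (X : {RV P >-> R}) (Y : {RV P' >-> R}) : Prop :=
  forall B : set R, measurable B -> distribution P X B = distribution P' Y B.

(* (X2 | X1) <=_S (Y2 | Y1); equality in distribution of X2 and Y2, the domain
   of the relation, is part of the definition. *)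
Definition cond_schur_le (X2 X1 : {RV P >-> R}) (Y2 Y1 : {RV P' >-> R}) : Prop :=
  eq_in_distribution X2 Y2 /\
  forall y : R, schur_le (cond_cdf X2 X1 y \o quantile X1)
                         (cond_cdf Y2 Y1 y \o quantile Y1).

End conditional_schur_order.

(* Main.v *)
(** For fixed [v] the map [u |-> C u v] of an extreme-value copula is concave:
    a support line of the Pickands function [A] bounds [C u v] above by some
    [c * u ^ a] with [0 <= a <= 1], with equality at a prescribed point.  Hence
    the partial derivative of [C] in [u], and likewise any version of
    [P(V <= v | U = u)], is almost everywhere equal to a nonincreasing
    selection [m] of supergradients.
    Such a function is its own decreasing rearrangement, and its integral over
    [(0, x)] is [C x v].  Each of the Schur orders therefore amounts to
    [D1 <= D2] pointwise, which is equivalent to [A1 >= A2] because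
    [ln (u * v) < 0]; the statements about the second variable follow by
    exchanging the arguments of [C] and replacing [A t] by [A (1 - t)]. *)

Require Import Defs.
From HB Require Import structures.
From mathcomp Require Import all_boot all_order all_algebra.
From mathcomp Require Import all_classical all_reals all_analysis.
From mathcomp Require Import unstable measurable_realfun ring lra.

Import Order.TTheory GRing.Theory Num.Theory.
Import numFieldNormedType.Exports.

Local Open Scope classical_set_scope.
Local Open Scope ring_scope.

(** * Concave functions and their supergradients *)

Section supergradients.
Context {R : realType}.
Implicit Types F m : R -> R.

(** The inequality is tested up to the endpoints of [0, 1], so that integrating [m] recovers [F]
    from the value [F 0] on. *)
Definition supergradient F m : Prop :=
  {in `]0, 1[, forall x : R, 0 <= m x <= 1 /\
     {in `[0, 1], forall y : R, F y <= F x + m x * (y - x)}}.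

Definition noninc01 m : Prop := {in `]0, 1[ &, nonincreasing_fun m}.

(** Add the supergradient inequalities at [x] and at [y], each evaluated at the other point. *)
Lemma supergradient_nonincreasing F m : supergradient F m -> noninc01 m.
Proof.
move=> Fm x y x01 y01; rewrite le_eqVlt => /predU1P[->//|xy].
have y01' : y \in `[0, 1] by exact: subset_itv_oo_cc.
have x01' : x \in `[0, 1] by exact: subset_itv_oo_cc.
have [_ /(_ _ y01') h1] := Fm _ x01.
have [_ /(_ _ x01') h2] := Fm _ y01.
have : 0 <= (m x - m y) * (y - x) by nra.
by rewrite pmulr_lge0 ?subr_gt0// subr_ge0.
Qed.

(* A rational [q] separates the left and right limits of [m] at one point at
   most, so the set of jumps is countable. *)
Definition jumps m : set R := \bigcup_(q : rat) [set x | [/\ x \in `]0, 1[,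
  {in `]0, 1[, forall y, y < x -> ratr q < m y} &
  {in `]0, 1[, forall y, x < y -> m y < ratr q}]].

Lemma countable_jumps m : countable (jumps m).
Proof.
apply: bigcup_countable => //.
move=> q _; set B := (X in countable X).
suff [->|[x ->]] : B = set0 \/ exists x, B = [set x].
  exact: countable0.
  exact: countable1.
have [->|/set0P[x Bx]] := eqVneq B set0; [by left|right; exists x].
apply/seteqP; split => [y By /=|y ->//].
(* At the midpoint of two such points [m] would be both below and above [q]. *)
have main a b : B a -> B b -> ~ a < b.
  move=> [a01 _ a2] [b01 b1 _] ab.
  have c01 : (a + b) / 2 \in `]0, 1[.
    by move: a01 b01; rewrite !in_itv/= => /andP[? ?] /andP[? ?]; lra.
  have := a2 _ c01; have := b1 _ c01.
  by move=> /(_ ltac:(lra)) p1 /(_ ltac:(lra)) p2; lra.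
by apply/eqP; rewrite eq_le !leNgt; apply/andP; split; apply/negP;
  exact: main.
Qed.

Lemma notin_jumps m x (q : rat) : ~ jumps m x -> x \in `]0, 1[ ->
  (exists2 y, y \in `]0, 1[ & y < x /\ m y <= ratr q) \/
  (exists2 y, y \in `]0, 1[ & x < y /\ ratr q <= m y).
Proof.
move=> xj x01; apply: contrapT => /not_orP[h1 h2]; apply: xj; exists q => //.
split=> // y y01 yx; rewrite ltNge; apply/negP => qm.
- by apply: h1; exists y.
- by apply: h2; exists y.
Qed.

(** By monotonicity no value to the right of [x] reaches a rational chosen strictly between [m x]
    and [m x + e], so only the left alternative of [notin_jumps] survives. *)
Lemma notin_jumps_left {m x} (e : R) : noninc01 m -> ~ jumps m x ->
  x \in `]0, 1[ -> 0 < e ->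
  exists2 y, y \in `]0, 1[ & y < x /\ m y < m x + e.
Proof.
move=> mm xj x01 e0.
have [q] := @rat_in_itvoo R (m x) (m x + e) ltac:(lra).
rewrite in_itv/= => /andP[q1 q2].
have [[y y01 [yx ym]]|[y y01 [xy my]]] := notin_jumps m x q xj x01.
  by exists y => //; split => //; lra.
have := mm _ _ x01 y01 (ltW xy); lra.
Qed.

Lemma notin_jumps_right {m x} (e : R) : noninc01 m -> ~ jumps m x ->
  x \in `]0, 1[ -> 0 < e ->
  exists2 y, y \in `]0, 1[ & x < y /\ m x - e < m y.
Proof.
move=> mm xj x01 e0.
have [q] := @rat_in_itvoo R (m x - e) (m x) ltac:(lra).
rewrite in_itv/= => /andP[q1 q2].
have [[y y01 [yx ym]]|[y y01 [xy my]]] := notin_jumps m x q xj x01.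
  have := mm _ _ y01 x01 (ltW yx); lra.
by exists y => //; split => //; lra.
Qed.

(** The supergradient inequalities at [x] and [t + x] place the difference quotient between [m x]
    and [m (t + x)], which are close when [x] is not a jump. *)
Lemma supergradient_derive1 F m x : supergradient F m -> x \in `]0, 1[ ->
  ~ jumps m x -> derive1 F x = m x.
Proof.
move=> Fm x01 xj; have mm := supergradient_nonincreasing _ _ Fm.
apply/cvg_lim => //; apply/cvgrPdist_lt => e e0.
have [y y01 [yx my]] := notin_jumps_left e mm xj x01 e0.
have [z z01 [xz mz]] := notin_jumps_right e mm xj x01 e0.
(* Within this radius [t + x] stays between [y] and [z], where monotonicity keeps [m] within [e] of
   [m x]. *)
have d0 : 0 < Num.min (x - y) (z - x) by rewrite lt_min; lra.
near=> t.
have t0 : t != 0 by near: t; exact: nbhs_dnbhs_neq.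
have : `|t| < Num.min (x - y) (z - x).
  near: t; apply: dnbhs0_lt; exact: d0.
rewrite lt_min ltr_norml => /andP[/andP[t1 t2]].
rewrite ltr_norml => /andP[t3 t4].
have [y0 y1] : 0 < y /\ y < 1 by move: y01; rewrite in_itv/= => /andP.
have [z0 z1] : 0 < z /\ z < 1 by move: z01; rewrite in_itv/= => /andP.
have tx01 : t + x \in `]0, 1[ by rewrite in_itv/=; apply/andP; split; lra.
have [_ /(_ _ (subset_itv_oo_cc tx01)) h1] := Fm _ x01.
have [_ /(_ _ (subset_itv_oo_cc x01)) h2] := Fm _ tx01.
have [tp|tn] := ltP 0 t.
  have tz : t + x <= z by lra.
  have h3 := mm _ _ tx01 z01 tz.
  rewrite ltr_norml /=; apply/andP; split.
    rewrite ltrBrDl -ltrBrDr opprK [_ *: _]mulrC ltr_pdivrMr//; nra.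
  rewrite ltrBlDr -ltrBlDl [_ *: _]mulrC ltr_pdivlMr//; nra.
have {}tn : t < 0 by lra.
have yt : y <= t + x by lra.
have h3 := mm _ _ y01 tx01 yt.
rewrite ltr_norml /=; apply/andP; split.
  rewrite ltrBrDl -ltrBrDr opprK [_ *: _]mulrC ltr_ndivrMr//; nra.
rewrite ltrBlDr -ltrBlDl [_ *: _]mulrC ltr_ndivlMr//; nra.
Unshelve. all: by end_near. Qed.

(* The Riemann-sum error on a partition of step [x / n] telescopes to
   [(M 0 - M x) * x / n]. *)
Lemma primitive_unique (M G H : R -> R) x : 0 <= x <= 1 ->
  (forall a b, 0 <= a -> a <= b -> b <= 1 ->
     M b * (b - a) <= G b - G a <= M a * (b - a)) ->
  (forall a b, 0 <= a -> a <= b -> b <= 1 ->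
     M b * (b - a) <= H b - H a <= M a * (b - a)) ->
  G x - G 0 = H x - H 0.
Proof.
move=> /andP[x0 x1] MG MH; pose K y := G y - H y.
have MK a b : 0 <= a -> a <= b -> b <= 1 ->
    `|K b - K a| <= (M a - M b) * (b - a).
  move=> a0 ab b1; have /andP[g1 g2] := MG _ _ a0 ab b1.
  have /andP[h1 h2] := MH _ _ a0 ab b1.
  by rewrite ler_norml /K; apply/andP; split; lra.
(* A bound of order 1 / n for every [n] forces [K x = K 0]. *)
suff KE n : `|K x - K 0| <= (M 0 - M x) * x / n.+1%:R.
  apply/eqP; rewrite -subr_eq0 -normr_le0.
  rewrite (_ : _ - _ = K x - K 0); last by rewrite /K; ring.
  have c0 : 0 <= (M 0 - M x) * x.
    by have := MK 0 x (lexx _) x0 x1; rewrite subr0; exact: le_trans.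
  rewrite leNgt; apply/negP => D0.
  have := archi_boundP (divr_ge0 c0 (ltW D0)); rewrite ltr_pdivrMr//.
  have := KE (Num.bound ((M 0 - M x) * x / `|K x - K 0|)).
  by rewrite ler_pdivlMr ?ltr0n// -natr1; nra.
pose s i : R := x / n.+1%:R * i%:R.
have n0 : 0 < n.+1%:R :> R by rewrite ltr0n.
have step0 : 0 <= x / n.+1%:R by rewrite divr_ge0.
have sn : s n.+1 = x by rewrite /s divfK// gt_eqF.
have sS i : s i.+1 = s i + x / n.+1%:R by rewrite /s -natr1; ring.
suff: forall i, (i <= n.+1)%N ->
    `|K (s i) - K 0| <= (M 0 - M (s i)) * (x / n.+1%:R).
  by move=> /(_ n.+1 (leqnn _)); rewrite sn mulrA.
elim=> [_|i IH iN]; first by rewrite /s mulr0 !subrr normr0 mul0r.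
have {}IH := IH (ltnW iN).
have si0 : 0 <= s i by rewrite /s mulr_ge0.
have sle : s i <= s i.+1 by rewrite sS lerDl.
have s1 : s i.+1 <= 1.
  by apply: le_trans x1; rewrite -[leRHS]sn /s ler_wpM2l// ler_nat.
have := MK _ _ si0 sle s1.
rewrite (_ : s i.+1 - s i = x / n.+1%:R); last by rewrite sS; ring.
move: (x / _) IH => d; rewrite !ler_norml => /andP[h1 h2] /andP[h3 h4].
by apply/andP; split; lra.
Qed.

(** Puts the indefinite integral of [M] under the hypothesis of [primitive_unique]. *)
Lemma ge0_integral_nonincreasing_bounds (M : R -> R) a b :
  nonincreasing_fun M -> (forall x, 0 <= M x) -> a <= b ->
  ((M b * (b - a))%:E <= \int[lebesgue_measure]_(t in `[a, b[) (M t)%:E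
     <= (M a * (b - a))%:E)%E.
Proof.
move=> Mni M0 ab.
have mM (D : set R) : measurable D -> measurable_fun D (fun t : R => (M t)%:E).
  by move=> mD; apply/measurable_EFinP; exact: nonincreasing_measurable.
have cE (c : R) : 0 <= c ->
    (\int[lebesgue_measure]_(t in `[a, b[) c%:E = (c * (b - a))%:E)%E.
  move=> c0; rewrite integral_cst//= lebesgue_measure_itv/= lte_fin.
  have [->|anb] := eqVneq a b; first by rewrite ltxx subrr mulr0 mule0.
  by rewrite lt_neqAle anb ab.
rewrite -!cE//; apply/andP; split; apply: ge0_le_integral => //=.
- by move=> x _; rewrite lee_fin.
- exact: mM.
- by move=> x; rewrite in_itv/= => /andP[_ /ltW xb]; rewrite lee_fin Mni.
- by move=> x _; rewrite lee_fin.
- exact: mM.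
- by move=> x; rewrite in_itv/= => /andP[ax _]; rewrite lee_fin Mni.
Qed.

(* With these values outside (0, 1), a supergradient of a nondecreasing
   1-Lipschitz function becomes nonincreasing on the whole line. *)
Definition extend01 m x : R := if x <= 0 then 1 else if 1 <= x then 0 else m x.

Lemma extend01E m x : x \in `]0, 1[ -> extend01 m x = m x.
Proof. by rewrite in_itv/= /extend01 => /andP[x0 x1]; rewrite !leNgt x0 x1. Qed.

Lemma extend01_ge0 F m x : supergradient F m -> 0 <= extend01 m x <= 1.
Proof.
move=> Fm; rewrite /extend01; case: ifPn => [_|]; first by rewrite ler01 lexx.
rewrite -ltNge => x0; case: ifPn => [_|]; first by rewrite ler01 lexx.
by rewrite -ltNge => x1; have [] := Fm x; rewrite ?in_itv/= ?x0.
Qed.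

Lemma extend01_nonincreasing F m : supergradient F m ->
  nonincreasing_fun (extend01 m).
Proof.
move=> Fm x y xy.
have [x0|x0] := leP x 0.
  by rewrite [leRHS]/extend01 x0; have /andP[] := extend01_ge0 _ _ y Fm.
have [y1|y1] := leP 1 y.
  rewrite [leLHS]/extend01 y1 (lt_geF (lt_le_trans x0 xy)).
  by have /andP[] := extend01_ge0 _ _ x Fm.
have x01 : x \in `]0, 1[ by rewrite in_itv/= x0 (le_lt_trans xy).
have y01 : y \in `]0, 1[ by rewrite in_itv/= y1 (lt_le_trans x0).
by rewrite !extend01E//; apply: (supergradient_nonincreasing _ _ Fm).
Qed.

Definition nondecreasing_lip01 F : Prop :=
  forall x y, 0 <= x -> x <= y -> y <= 1 -> 0 <= F y - F x <= y - x.

(** Over [a, b] the increments of [F] and of the integral of [M] both lie between [M b * (b - a)]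
    and [M a * (b - a)], so [primitive_unique] applies. *)
Lemma supergradient_integral F m (x : R) :
  nondecreasing_lip01 F -> supergradient F m -> 0 <= x <= 1 ->
  (\int[lebesgue_measure]_(t in `]0%R, x[) (m t)%:E = (F x - F 0)%:E)%E.
Proof.
move=> lF Fm x01; pose M := extend01 m.
have Mni : nonincreasing_fun M := extend01_nonincreasing _ _ Fm.
have M0 y : 0 <= M y by have /andP[] := extend01_ge0 _ _ y Fm.
have mM (D : set R) : measurable D -> measurable_fun D (fun t : R => (M t)%:E).
  by move=> mD; apply/measurable_EFinP; exact: nonincreasing_measurable.
pose G y := (\int[lebesgue_measure]_(t in `[0%R, y[) (M t)%:E)%E.
have Gfin y : 0 <= y -> G y \is a fin_num.
  move=> y0.
  have /andP[_ h] := ge0_integral_nonincreasing_bounds _ _ _ Mni M0 y0.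
  rewrite ge0_fin_numE ?(le_lt_trans h) ?ltry//.
  by apply: integral_ge0 => t _; rewrite lee_fin.
transitivity (G x).
  rewrite /G -(@integral_itv_obnd_cbnd _ 0 (BLeft x)); last exact: mM.
  apply: eq_integral => t; rewrite inE/= in_itv/= => /andP[t0 tx].
  rewrite /M extend01E// in_itv/= t0.
  by case/andP: x01 => _; exact: lt_le_trans.
have [x0 x1] := andP x01.
rewrite -(fineK (Gfin _ x0)); congr EFin.
rewrite -[LHS]subr0 -[X in _ - X](_ : fine (G 0) = 0); last first.
  by rewrite /G set_itvco0 integral_set0.
apply: (primitive_unique M (fine \o G)) => // a b a0 ab b1; last first.
  have [->|anb] := eqVneq a b; first by rewrite !subrr !mulr0 lexx.
  have {}ab : a < b by rewrite lt_neqAle anb.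
  have a01 : a \in `[0, 1] by rewrite in_itv/=; lra.
  have b01 : b \in `[0, 1] by rewrite in_itv/=; lra.
  have /andP[l1 l2] := lF _ _ a0 (ltW ab) b1.
  (* For [F] these are the supergradient inequalities at [b] and at [a]. If [b = 1] or [a = 0], the
     values 0 and 1 of [extend01] reduce them to monotonicity and to the Lipschitz bound. *)
  apply/andP; split.
    rewrite /M /extend01; case: ifPn => [|_]; first by lra.
    case: ifPn => [|]; first by lra.
    rewrite -ltNge => b1'.
    have [|_ /(_ _ a01)] := Fm b; first by rewrite in_itv/=; lra.
    by lra.
  rewrite /M /extend01; case: ifPn => [|]; first by lra.
  rewrite -ltNge => a0'; case: ifPn => [|]; first by lra.
  rewrite -ltNge => a1'.
  have [|_ /(_ _ b01)] := Fm a; first by rewrite in_itv/=; lra.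
  by lra.
have GE : (G b = G a + \int[lebesgue_measure]_(t in `[a, b[) (M t)%:E)%E.
  rewrite /G -ge0_integral_setU//=.
  - by rewrite -itv_bndbnd_setU// bnd_simp.
  - by apply: mM; apply: measurableU; exact: measurable_itv.
  - by move=> t _; rewrite lee_fin.
  - apply/disj_setPLR => t; rewrite /= !in_itv/= => /andP[_ ta].
    by move=> /andP[]; rewrite leNgt ta.
have b0 := le_trans a0 ab.
have := ge0_integral_nonincreasing_bounds _ _ _ Mni M0 ab.
set I := integral _ _ _ in GE *.
have -> : I = (fine (G b) - fine (G a))%:E.
  by rewrite EFinB !fineK ?Gfin// GE addeAC subee ?Gfin// add0e.
by rewrite !lee_fin.
Qed.

End supergradients.

(** * Decreasing rearrangements *)

Section rearrangements.
Context {R : realType}.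
Implicit Types F m h f g : R -> R.
Local Notation mu := (@lebesgue_measure R).
Local Notation I01 := (`]0, 1[%classic : set R).

(** The superlevel sets in (0, 1) are intervals. *)
Lemma noninc01_measurable f : noninc01 f -> measurable_fun I01 f.
Proof.
move=> fni.
apply: (measurability (@RGenCInfty.G R)) => [|/= _ [_] [r] -> <-].
  exact: RGenCInfty.measurableE.
apply: is_interval_measurable => s t /=.
rewrite !in_itv/= !andbT => -[s01 fs] [t01 ft] u /andP[su ut].
have u01 : u \in `]0, 1[ by rewrite in_itv/=; lra.
split; first exact: u01.
by rewrite /= in_itv/= andbT (le_trans ft)// fni// in_itv.
Qed.

Lemma level_setE f w : [set t : R | 0 < t < 1 /\ w <= f t] =
  I01 `&` f @^-1` `[w, +oo[.
Proof. by apply/seteqP; split=> t /=; rewrite !in_itv/= andbT. Qed.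

Lemma measurable_level f w : measurable_fun I01 f ->
  measurable [set t : R | 0 < t < 1 /\ w <= f t].
Proof. by move=> mf; rewrite level_setE; exact: mf. Qed.

Lemma rearrangement_ae_eq h m : noninc01 m -> measurable_fun I01 h ->
  ae_eq mu I01 h m -> is_decreasing_rearrangement h m.
Proof.
move=> mni mh hm; split => // w.
pose L f := [set t : R | 0 < t < 1 /\ w <= f t].
(* The superlevel set of [f] lies in that of [g] up to a null set; by symmetry one inequality
   suffices. *)
have main f g : measurable_fun I01 f -> measurable_fun I01 g ->
    ae_eq mu I01 f g ->
    (mu (L f) <= mu (L g))%E.
  move=> mf mg [N [mN N0 fgN]].
  have mg' := measurable_level _ w mg.
  rewrite -[leRHS]adde0 -[X in (_ <= _ + X)%E]N0.
  apply: le_trans (measureU2 _ _ _) => //.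
  apply: le_measure; rewrite ?inE//.
  - exact: measurable_level.
  - exact: measurableU.
  - move=> t [t01 wt]; have [Nt|Nt] := pselect (N t); [by right|left].
    split => //; suff <- : f t = g t by [].
    by apply: contrapT => fg; apply/Nt/fgN => /(_ t01).
have mm := noninc01_measurable _ mni.
apply/eqP; rewrite eq_le; apply/andP; split; apply: main => //.
exact: ae_eq_sym.
Qed.

(** If [g s < f t], then at level [f t] the superlevel set of [f] contains (0, t] while that of [g]
    lies in (0, s], which is strictly smaller in measure. *)
Lemma equimeasurable_le f g s t : noninc01 f -> noninc01 g ->
  (forall w, mu [set t : R | 0 < t < 1 /\ w <= f t] =
             mu [set t : R | 0 < t < 1 /\ w <= g t]) ->
  s \in `]0, 1[ -> t \in `]0, 1[ -> s < t -> f t <= g s.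
Proof.
move=> fni gni fg s01 t01 st; rewrite leNgt; apply/negP => gf.
have := fg (f t); apply/eqP; rewrite gt_eqF//.
have [s0 s1] : 0 < s /\ s < 1 by move: s01; rewrite in_itv/= => /andP.
have [t0 t1] : 0 < t /\ t < 1 by move: t01; rewrite in_itv/= => /andP.
apply: (@le_lt_trans _ _ (mu `]0, s])).
  apply: le_measure; rewrite ?inE//.
  - by apply: measurable_level; exact: noninc01_measurable.
  - move=> u [u01 fu]; rewrite /= in_itv/=; apply/andP; split; first by lra.
    rewrite leNgt; apply/negP => su.
    have u01' : u \in `]0, 1[ by rewrite in_itv.
    have := gni _ _ s01 u01' (ltW su); lra.
apply: (@lt_le_trans _ _ (mu `]0, t])).
  by rewrite !lebesgue_measure_itv/= !lte_fin s0 t0 -!EFinB lte_fin; lra.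
apply: le_measure; rewrite ?inE//.
- by apply: measurable_level; exact: noninc01_measurable.
- move=> u; rewrite /= in_itv/= => /andP[u0 ut].
  have u1 : 0 < u < 1 by lra.
  have u01' : u \in `]0, 1[ by rewrite in_itv.
  by split => //; exact: fni.
Qed.

(** Essential uniqueness of the decreasing rearrangement: off the jumps, [g t] is approached by
    values of [g] on either side of [t], and [equimeasurable_le] compares these with [f t]. *)
Lemma equimeasurable_eq f g t : noninc01 f -> noninc01 g ->
  (forall w, mu [set t : R | 0 < t < 1 /\ w <= f t] =
             mu [set t : R | 0 < t < 1 /\ w <= g t]) ->
  t \in `]0, 1[ -> ~ jumps g t -> f t = g t.
Proof.
move=> fni gni fg t01 tj; have gf w := esym (fg w).
apply/eqP; rewrite eq_le; apply/andP; split; rewrite leNgt; apply/negP => lt.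
- have [|s s01 [st gs]] := notin_jumps_left (f t - g t) gni tj t01.
    by rewrite subr_gt0.
  have := equimeasurable_le _ _ _ _ fni gni fg s01 t01 st; lra.
- have [|s s01 [st gs]] := notin_jumps_right (g t - f t) gni tj t01.
    by rewrite subr_gt0.
  have := equimeasurable_le _ _ _ _ gni fni gf t01 s01 st; lra.
Qed.

Lemma ae_eq_off_countable (C : set R) f g : countable C ->
  (forall t, t \in `]0, 1[ -> ~ C t -> f t = g t) -> ae_eq mu I01 f g.
Proof.
move=> cC fg; exists C; split.
- by apply: countable_measurable => // x; exact: measurable_set1.
- exact: countable_lebesgue_measure0.
- by move=> t /not_implyP[t01]; apply: contra_notP => Ct; exact: fg.
Qed.

(** The function picked by [get] is known only through its specification. As [m] satisfies the same
    specification, the two agree off the jumps of [m]. *)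
Lemma integral_decreasing_rearrangement h m x : noninc01 m ->
  measurable_fun I01 h -> ae_eq mu I01 h m -> 0 <= x <= 1 ->
  (\int[mu]_(t in `]0%R, x[) (decreasing_rearrangement h t)%:E =
   \int[mu]_(t in `]0%R, x[) (m t)%:E)%E.
Proof.
move=> mni mh hm /andP[x0 x1].
have mr := rearrangement_ae_eq _ _ mni mh hm.
have [hsni hs] : is_decreasing_rearrangement h (decreasing_rearrangement h).
  by apply: (@getPex _ [set hs | is_decreasing_rearrangement h hs]); exists m.
have sub : `]0, x[%classic `<=` I01 by apply: subset_itvl; rewrite bnd_simp.
apply: ae_eq_integral => //.
- apply/measurable_EFinP; apply: measurable_funS sub _ => //.
  exact: noninc01_measurable.
- apply/measurable_EFinP; apply: measurable_funS sub _ => //.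
  exact: noninc01_measurable.
- apply: ae_eq_comp.
  suff: ae_eq mu I01 (decreasing_rearrangement h) m.
    by apply: filterS => t hmt /sub/hmt.
  apply: (@ae_eq_off_countable (jumps m)); first exact: countable_jumps.
  move=> t t01 tj; apply: equimeasurable_eq => // w.
  by rewrite hs mr.2.
Qed.

(** Every subset of a countable set is Borel, so arbitrary values on [C] do no harm; a mere null set
    would not be enough. *)
Lemma measurable_off_countable (C : set R) f g : countable C ->
  measurable_fun I01 g ->
  (forall t, t \in `]0, 1[ -> ~ C t -> f t = g t) -> measurable_fun I01 f.
Proof.
move=> cC mg fg mD B mB.
have mC (A : set R) : A `<=` C -> measurable A.
  move=> AC; apply: countable_measurable; last first.
    by apply: sub_countable cC; exact: subset_card_le.
  by move=> x; exact: measurable_set1.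
rewrite (_ : _ `&` _ = ((I01 `&` g @^-1` B) `\` C)
                       `|` (I01 `&` f @^-1` B `&` C)).
  apply: measurableU; last by apply: mC => x [].
  by apply: measurableD; [exact: mg|exact: mC].
apply/seteqP; split => x /=.
- move=> [x01 fB]; have [Cx|Cx] := pselect (C x); first by right.
  by left; split => //; split => //; rewrite -fg.
- by move=> [[[x01 gB] Cx]|[]//]; split => //; rewrite fg.
Qed.

(** Common interface of the functions that the Schur orders compare: partial derivatives of a
    copula, and conditional distribution functions composed with a quantile function. *)
Definition ae_slope F h : Prop := exists m,
  [/\ nondecreasing_lip01 F, F 0 = 0, supergradient F m, measurable_fun I01 h &
      ae_eq mu I01 h m].

(* At the jumps of [m] the derivative does not exist and [derive1] is a junk
   value; since the jumps are countable, [derive1 F] is nevertheless Borel. *)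
Lemma ae_slope_derive1 F m :
  nondecreasing_lip01 F -> F 0 = 0 -> supergradient F m ->
  ae_slope F (derive1 F).
Proof.
move=> lF F0 Fm; exists m; have mni := supergradient_nonincreasing _ _ Fm.
have cj := countable_jumps m.
have Fj t : t \in `]0, 1[ -> ~ jumps m t -> derive1 F t = m t.
  exact: supergradient_derive1.
split => //; last exact: ae_eq_off_countable Fj.
by apply: measurable_off_countable Fj => //; exact: noninc01_measurable.
Qed.

Lemma ae_slope_integral F h x : ae_slope F h -> 0 <= x <= 1 ->
  (\int[mu]_(t in `]0%R, x[) (decreasing_rearrangement h t)%:E = (F x)%:E)%E.
Proof.
move=> [m [lF F0 Fm mh hm]] x01.
rewrite (integral_decreasing_rearrangement _ m)//; last first.
  exact: supergradient_nonincreasing Fm.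
by rewrite (supergradient_integral F)// F0 subr0.
Qed.

Lemma ae_slope_integrable F h : ae_slope F h ->
  mu.-integrable I01 (EFin \o h).
Proof.
move=> [m [lF F0 Fm mh hm]].
have mm := noninc01_measurable _ (supergradient_nonincreasing _ _ Fm).
apply/integrableP; split; first exact/measurable_EFinP.
have -> : (\int[mu]_(t in I01) `|(EFin \o h) t| =
           \int[mu]_(t in I01) (m t)%:E)%E.
  apply: ae_eq_integral => //.
  - by apply: measurableT_comp => //; exact/measurable_EFinP.
  - exact/measurable_EFinP.
  - apply: filterS hm => t hmt t01; rewrite /= hmt// ger0_norm//.
    by have [/andP[]] := Fm t t01.
by rewrite (supergradient_integral F) ?ltry// ler01 lexx.
Qed.

(** By [ae_slope_integral] the integrals over (0, x) are [F1 x] and [F2 x]; the condition at 1 is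
    the equality of the total integrals. *)
Lemma schur_le_slope F1 F2 h1 h2 : ae_slope F1 h1 -> ae_slope F2 h2 ->
  F1 1 = F2 1 ->
  schur_le h1 h2 <-> {in `]0, 1[, forall x, F1 x <= F2 x}.
Proof.
move=> s1 s2 F12.
have i1 x (x01 : 0 <= x <= 1) := ae_slope_integral _ _ x s1 x01.
have i2 x (x01 : 0 <= x <= 1) := ae_slope_integral _ _ x s2 x01.
split=> [[_ _ h12 _] x x01|h12].
  by have := h12 _ x01; rewrite i1 ?i2 ?lee_fin//;
    apply: (subset_itv_oo_cc x01).
split.
- exact: ae_slope_integrable s1.
- exact: ae_slope_integrable s2.
- move=> x x01; rewrite i1 ?i2 ?lee_fin//; first exact: h12;
    by apply: (subset_itv_oo_cc x01).
- by rewrite i1 ?i2 ?F12// ler01 lexx.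
Qed.

End rearrangements.

(** * Extreme-value copulas *)

Section ev_copulas.
Context {R : realType}.
Implicit Types (A : R -> R) (C D : R -> R -> R).

(** The rectangle [x, y] x [0, v] gives monotonicity and [x, y] x [v, 1] gives the Lipschitz
    bound. *)
Lemma copula_lip01 C v : is_copula C -> v \in `[0, 1] ->
  nondecreasing_lip01 (C ^~ v).
Proof.
move=> [_ C0 C1 C2] v01 x y x0 xy y1.
have [v0 v1] : 0 <= v /\ v <= 1 by move: v01; rewrite in_itv/= => /andP.
have y0 := le_trans x0 xy; have x1 := le_trans xy y1.
have x01 : x \in `[0, 1] by rewrite in_itv/= x0.
have y01 : y \in `[0, 1] by rewrite in_itv/= y0.
have := C2 _ _ _ _ x0 xy y1 (lexx 0) v0 v1.
have := C2 _ _ _ _ x0 xy y1 v0 v1 (lexx 1).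
have [-> _] := C0 _ x01; have [-> _] := C0 _ y01.
have [-> _] := C1 _ x01; have [-> _] := C1 _ y01.
by move=> ? ?; apply/andP; split; lra.
Qed.

Lemma pickands_convex A x y p : is_pickands A ->
  x \in `[0, 1] -> y \in `[0, 1] -> 0 <= p -> p <= 1 ->
  A (p * x + (1 - p) * y) <= p * A x + (1 - p) * A y.
Proof.
move=> [cA _] x01 y01 p0 p1.
by have := cA (Itv01 p0 p1) x y; rewrite !inE => /(_ x01 y01).
Qed.

Lemma pickands_bounds A t : is_pickands A -> t \in `[0, 1] ->
  [/\ t <= A t, 1 - t <= A t & A t <= 1].
Proof. by move=> [_ bA] /bA; rewrite ge_max => /andP[/andP[? ?] ?]. Qed.

Lemma pickands_slopes A t0 t r : is_pickands A ->
  0 <= t -> t < t0 -> t0 < r -> r <= 1 ->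
  (A t0 - A t) / (t0 - t) <= (A r - A t0) / (r - t0).
Proof.
move=> pA t_ge0 tt0 t0r r1.
have t01 : t \in `[0, 1] by rewrite in_itv/=; apply/andP; split; lra.
have r01 : r \in `[0, 1] by rewrite in_itv/=; apply/andP; split; lra.
have rt : 0 < r - t by lra.
pose p := (r - t0) / (r - t).
have p0 : 0 <= p by rewrite divr_ge0//; lra.
have p1 : p <= 1 by rewrite ler_pdivrMr//; lra.
have := pickands_convex _ _ _ _ pA t01 r01 p0 p1.
have -> : p * t + (1 - p) * r = t0.
  by rewrite /p; field; lra.
have -> : p * A t + (1 - p) * A r =
    ((r - t0) * A t + (t0 - t) * A r) / (r - t).
  by rewrite /p; field; lra.
rewrite ler_pdivlMr// => h.
rewrite ler_pdivrMr ?subr_gt0// mulrAC ler_pdivlMr ?subr_gt0//.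
by lra.
Qed.

(** The supremum of the slopes of chords ending at [t0] serves: [pickands_slopes] bounds it by the
    slope of every chord starting at [t0]. *)
Lemma pickands_support A t0 : is_pickands A -> t0 \in `]0, 1[ ->
  exists s, {in `[0, 1], forall t, A t0 + s * (t - t0) <= A t}.
Proof.
move=> pA; rewrite in_itv/= => /andP[t00 t01].
pose E := [set (A t0 - A t) / (t0 - t) | t in `[0, t0[].
have ubE r : t0 < r -> r <= 1 -> ubound E ((A r - A t0) / (r - t0)).
  move=> t0r r1 y [t /=]; rewrite in_itv/= => /andP[t_ge0 tt0] <-.
  exact: pickands_slopes.
have E0 : E !=set0.
  by exists ((A t0 - A 0) / (t0 - 0)), 0 => //=; rewrite in_itv/= lexx.
have hE : has_ubound E by exists ((A 1 - A t0) / (1 - t0)); exact: ubE.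
exists (sup E) => t; rewrite in_itv/= => /andP[t_ge0 t1].
have [tt0|tt0|->] := ltgtP t t0; last by rewrite subrr mulr0 addr0.
- have : (A t0 - A t) / (t0 - t) <= sup E.
    by apply: ub_le_sup => //; exists t => //=; rewrite in_itv/= t_ge0.
  by rewrite ler_pdivrMr ?subr_gt0//; lra.
- have : sup E <= (A t - A t0) / (t - t0) by apply: ge_sup => //; exact: ubE.
  by rewrite ler_pdivlMr ?subr_gt0//; lra.
Qed.

(** With [x = expR d] this is x^a <= 1 + a (x - 1), the tangent at 1 of a concave power; it is the
    convexity of [expR] between 0 and [d]. *)
Lemma expR_bernoulli (a d : R) : 0 <= a -> a <= 1 ->
  expR (a * d) <= 1 + a * (expR d - 1).
Proof.
move=> a0 a1; have := convex_expR (Itv01 a0 a1) d 0.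
rewrite !convRE/= mulr0 addr0 expR0 mulr1 /unstable.onem.
by move/le_trans; apply; lra.
Qed.

Lemma ln_in01 (u : R) : u \in `]0, 1[ -> ln u < 0 /\ expR (ln u) = u.
Proof.
rewrite in_itv/= => /andP[u0 u1]; split; first by rewrite ln_lt0// u0.
by rewrite lnK.
Qed.

(* A support line [t |-> L + s * (t - t0)] of [A] bounds [C u v] by
   [c * u ^ a] with [a = L - s * t0] in [0, 1], which is concave in [u]. *)
Lemma ev_copula_tangent A C u0 v : is_ev_copula A C ->
  u0 \in `]0, 1[ -> v \in `]0, 1[ -> exists2 m, 0 <= m <= 1 &
    {in `[0, 1], forall u, C u v <= C u0 v + m * (u - u0)}.
Proof.
move=> [cC pA CE] u001 v01.
have v01' : v \in `[0, 1] by exact: subset_itv_oo_cc.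
have lip := copula_lip01 _ _ cC v01'.
have [_ C0 C1 _] := cC.
have [u00 u01] : 0 < u0 /\ u0 < 1 by move: u001; rewrite in_itv/= => /andP.
have [v0 v1] : 0 < v /\ v < 1 by move: v01; rewrite in_itv/= => /andP.
have [lu0 eu0] := ln_in01 _ u001; have [lv ev] := ln_in01 _ v01.
have C0v : C 0 v = 0 by have [] := C0 _ v01'.
have C1v : C 1 v = v by have [] := C1 _ v01'.
have CEE u : u \in `]0, 1[ -> C u v =
    expR ((ln u + ln v) * A (ln v / (ln u + ln v))).
  move=> u01'; have /andP[u_gt0 _] : 0 < u < 1 by move: u01'; rewrite in_itv.
  by rewrite CE// lnM ?posrE.
have t01 u : u \in `]0, 1[ -> ln v / (ln u + ln v) \in `]0, 1[.
  move=> /ln_in01[lu _]; have lt0 : ln u + ln v < 0 by lra.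
  by rewrite in_itv/= ltr_ndivrMr// ltr_ndivlMr//; apply/andP; split; lra.
pose t0 := ln v / (ln u0 + ln v).
have t001 : t0 \in `]0, 1[ by exact: t01.
have [t00 t0_1] : 0 < t0 /\ t0 < 1 by move: t001; rewrite in_itv/= => /andP.
have [s sA] := pickands_support _ _ pA t001.
have [t0A _ _] := pickands_bounds _ _ pA (subset_itv_oo_cc t001).
have z01 : (0 : R) \in `[0, 1] by rewrite in_itv/= lexx ler01.
have o01 : (1 : R) \in `[0, 1] by rewrite in_itv/= lexx ler01.
have [_ _ A0] := pickands_bounds _ _ pA z01.
have [_ _ A1] := pickands_bounds _ _ pA o01.
have s0 := sA _ z01; have s1 := sA _ o01.
(* [a] and [a + s] are the values of the support line at 0 and 1, hence at most 1; [0 <= a] combines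
   the bound at 1 with [t0 <= A t0]. *)
pose a := A t0 - s * t0.
have a0 : 0 <= a by rewrite /a; nra.
have a1 : a <= 1 by rewrite /a; lra.
(* The constant c is [expR k], that is v^(a + s). *)
pose k := (a + s) * ln v.
have kv : ln v <= k by rewrite /k /a; nra.
have Cle u : u \in `]0, 1[ -> C u v <= expR (a * ln u + k).
  move=> u01'; rewrite CEE// ler_expR.
  have [lu _] := ln_in01 _ u01'; have lt0 : ln u + ln v < 0 by lra.
  have := sA _ (subset_itv_oo_cc (t01 _ u01')).
  rewrite -(ler_nM2l lt0) => /le_trans; apply.
  rewrite le_eqVlt; apply/orP; left; apply/eqP.
  by rewrite /k /a; field; lra.
have C0E : C u0 v = expR (a * ln u0 + k).
  rewrite CEE//; congr expR; rewrite -/t0 /k /a.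
  have : s * (t0 * (ln u0 + ln v)) = s * ln v.
    by congr *%R; rewrite /t0 divfK//; lra.
  by lra.
have Cu0 : 0 < C u0 v by rewrite C0E expR_gt0.
have Cu01 : C u0 v <= u0.
  by have := lip 0 u0 (lexx _) (ltW u00) (ltW u01); rewrite C0v; lra.
(* The derivative of c u^a at [u0], where c u0^a equals [C u0 v]; it is at most 1 since
   [C u0 v <= u0]. *)
exists (C u0 v * a / u0).
  apply/andP; split; first by rewrite divr_ge0 ?mulr_ge0// ltW.
  by rewrite ler_pdivrMr// mul1r; nra.
move=> u; rewrite in_itv/= => /andP[]; rewrite le_eqVlt => /predU1P[<- _|u_gt0].
  rewrite C0v sub0r mulrN divfK ?gt_eqF//; nra.
(* Tangent bound for c u^a at [u = expR d]; [d = 0] serves the endpoint 1, which the exponential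
   formula for [C] does not cover. *)
have bern d : expR (a * (d - ln u0) + (a * ln u0 + k)) <=
    C u0 v + C u0 v * a / u0 * (expR d - u0).
  rewrite expRD -C0E.
  have := expR_bernoulli _ (d - ln u0) a0 a1.
  rewrite -(ler_pM2r Cu0) => /le_trans; apply.
  rewrite expRD expRN eu0 le_eqVlt; apply/orP; left; apply/eqP.
  by field; lra.
rewrite le_eqVlt => /predU1P[->|u1].
  rewrite C1v; have := bern 0; rewrite expR0; apply: le_trans.
  by rewrite -[leLHS]ev ler_expR; lra.
have u01' : u \in `]0, 1[ by rewrite in_itv/= u_gt0.
apply: le_trans (Cle _ u01') _.
have := bern (ln u); have [_ ->] := ln_in01 _ u01'; apply: le_trans.
by rewrite ler_expR; lra.
Qed.

(** The endpoints [v = 0] and [v = 1], with slopes 0 and 1, are included because [clamp01] produces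
    them in the conditional distribution functions. *)
Lemma ev_copula_supergradient A C v : is_ev_copula A C -> v \in `[0, 1] ->
  exists m, supergradient (C ^~ v) m.
Proof.
move=> eC; have [[_ C0 C1 _] _ _] := eC.
rewrite in_itv/= => /andP[]; rewrite le_eqVlt => /predU1P[<- _|v0].
  exists (fun=> 0) => u u01; rewrite lexx ler01; split=> // y y01.
  have [-> _] := C0 _ y01; have [-> _] := C0 _ (subset_itv_oo_cc u01).
  by rewrite mul0r addr0.
rewrite le_eqVlt => /predU1P[->|v1].
  exists (fun=> 1) => u u01; rewrite lexx ler01; split=> // y y01.
  have [-> _] := C1 _ y01; have [-> _] := C1 _ (subset_itv_oo_cc u01).
  by lra.
have v01 : v \in `]0, 1[ by rewrite in_itv/= v0.
suff /choice[m Pm] : forall u, exists m : R, u \in `]0, 1[ -> 0 <= m <= 1 /\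
    {in `[0, 1], forall y : R, C y v <= C u v + m * (y - u)}.
  by exists m.
move=> u; have [u01|u01] := boolP (u \in `]0, 1[); last by exists 0.
by have [m m01 mC] := ev_copula_tangent _ _ _ _ eC u01 v01; exists m.
Qed.

Lemma le_lo_interior D1 D2 : is_copula D1 -> is_copula D2 ->
  {in `]0, 1[ &, forall u v, D1 u v <= D2 u v} -> le_lo D1 D2.
Proof.
move=> [_ C10 C11 _] [_ C20 C21 _] h u v u01 v01.
have [->|u0] := eqVneq u 0.
  by have [_ ->] := C10 _ v01; have [_ ->] := C20 _ v01.
have [->|u1] := eqVneq u 1.
  by have [_ ->] := C11 _ v01; have [_ ->] := C21 _ v01.
have [->|v0] := eqVneq v 0.
  by have [-> _] := C10 _ u01; have [-> _] := C20 _ u01.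
have [->|v1] := eqVneq v 1.
  by have [-> _] := C11 _ u01; have [-> _] := C21 _ u01.
have oo (x : R) : x \in `[0, 1] -> x != 0 -> x != 1 -> x \in `]0, 1[.
  by rewrite !in_itv/= !lt_neqAle eq_sym => /andP[-> ->] -> ->.
by apply: h; exact: oo.
Qed.

Lemma pickands_le_lo A1 A2 D1 D2 : is_ev_copula A1 D1 -> is_ev_copula A2 D2 ->
  {in `]0, 1[, forall t : R, A1 t >= A2 t} <-> le_lo D1 D2.
Proof.
move=> [cD1 _ D1E] [cD2 _ D2E]; split=> [A12|D12 t t01].
  apply: le_lo_interior => // u v u01 v01.
  have [lu _] := ln_in01 _ u01; have [lv _] := ln_in01 _ v01.
  rewrite D1E// D2E// ler_expR lnM ?posrE; last 2 first.
    by move: u01; rewrite in_itv/= => /andP[].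
    by move: v01; rewrite in_itv/= => /andP[].
  have lt0 : ln u + ln v < 0 by lra.
  rewrite ler_nM2l//; apply: A12.
  by rewrite in_itv/= ltr_ndivrMr// ltr_ndivlMr//; apply/andP; split; lra.
have [t0 t1] : 0 < t /\ t < 1 by move: t01; rewrite in_itv/= => /andP.
(* With [u = expR (- (1 - t))] and [v = expR (- t)], [ln (u * v)] is -1 and the argument of the
   Pickands functions is [t]. *)
have e01 (x : R) : 0 < x -> expR (- x) \in `]0, 1[.
  by move=> x0; rewrite in_itv/= expR_gt0 expR_lt1 oppr_lt0.
have u01 : expR (- (1 - t)) \in `]0, 1[ by apply: e01; lra.
have v01 := e01 _ t0.
have := D12 _ _ (subset_itv_oo_cc u01) (subset_itv_oo_cc v01).
rewrite D1E// D2E// ler_expR lnM ?posrE ?expR_gt0// !expRK.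
rewrite (_ : - (1 - t) + - t = -1); last by ring.
by rewrite invrN1 mulrN1 opprK !mulN1r lerN2.
Qed.

Lemma is_copula_swap C : is_copula C -> is_copula (fun u v => C v u).
Proof.
move=> [Cb C0 C1 C2]; split.
- by move=> u v u01 v01; exact: Cb.
- by move=> u /C0[].
- by move=> u /C1[].
- by move=> u1 u2 v1 v2 hu0 hu hu1 hv0 hv hv1;
    have := C2 _ _ _ _ hv0 hv hv1 hu0 hu hu1; lra.
Qed.

Lemma is_pickands_swap A : is_pickands A -> is_pickands (fun t => A (1 - t)).
Proof.
move=> pA; have f01 (t : R) : t \in `[0, 1] -> 1 - t \in `[0, 1].
  by rewrite !in_itv/= => /andP[? ?]; apply/andP; split; lra.
split => [p x y|t /f01 t01]; last first.
  have [h1 h2 ->] := pickands_bounds _ _ pA t01.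
  by rewrite andbT ge_max h1 (le_trans _ h2)//; lra.
rewrite !inE => x01 y01; have [cA _] := pA.
have := cA p (1 - x) (1 - y); rewrite !inE => /(_ (f01 _ x01) (f01 _ y01)).
apply: le_trans; rewrite le_eqVlt; apply/orP; left; apply/eqP; congr A.
pose q : R := p%:num.
change (1 - (q * x + (1 - q) * y) = q * (1 - x) + (1 - q) * (1 - y)).
ring.
Qed.

Lemma is_ev_copula_swap A C : is_ev_copula A C ->
  is_ev_copula (fun t => A (1 - t)) (fun u v => C v u).
Proof.
move=> [cC pA CE]; split.
- exact: is_copula_swap.
- exact: is_pickands_swap.
- move=> u v u01 v01; rewrite CE// [v * u]mulrC; congr (expR (_ * A _)).
  have [lu _] := ln_in01 _ u01; have [lv _] := ln_in01 _ v01.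
  by field; lra.
Qed.

Lemma ev_copula_slope A C v : is_ev_copula A C -> v \in `[0, 1] ->
  ae_slope (C ^~ v) (derive1 (C ^~ v)).
Proof.
move=> eC v01; have [cC _ _] := eC; have [_ C0 _ _] := cC.
have [m Cm] := ev_copula_supergradient _ _ _ eC v01.
apply: ae_slope_derive1 Cm; first exact: copula_lip01.
by have [] := C0 _ v01.
Qed.

Lemma le_d1S_le_lo A1 A2 D1 D2 : is_ev_copula A1 D1 -> is_ev_copula A2 D2 ->
  le_d1S D1 D2 <-> le_lo D1 D2.
Proof.
move=> eD1 eD2; have [cD1 _ _] := eD1; have [cD2 _ _] := eD2.
have [[_ _ D11 _] [_ _ D21 _]] := (cD1, cD2).
have main v : v \in `]0, 1[ ->
    schur_le (derive1 (fun u => D1 u v)) (derive1 (fun u => D2 u v)) <->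
    {in `]0, 1[, forall u, D1 u v <= D2 u v}.
  move=> /subset_itv_oo_cc v01; apply: (schur_le_slope (D1 ^~ v) (D2 ^~ v)).
  - by apply: (ev_copula_slope A1).
  - by apply: (ev_copula_slope A2).
  - by have [_ ->] := D11 _ v01; have [_ ->] := D21 _ v01.
split=> [D12|D12 v v01].
  apply: le_lo_interior => // u v u01 v01.
  by have /main := D12 _ v01; exact.
by apply/main => // u u01; apply: D12; exact: subset_itv_oo_cc.
Qed.

Lemma le_dS_le_lo A1 A2 D1 D2 : is_ev_copula A1 D1 -> is_ev_copula A2 D2 ->
  le_dS D1 D2 <-> le_lo D1 D2.
Proof.
move=> eD1 eD2.
have h1 : le_d1S D1 D2 <-> le_lo D1 D2 by exact: le_d1S_le_lo eD1 eD2.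
(* [le_d2S] is convertible to [le_d1S] of the transposed copulas. *)
have h2 : le_d2S D1 D2 <-> le_lo (fun u v => D1 v u) (fun u v => D2 v u).
  exact: le_d1S_le_lo (is_ev_copula_swap _ _ eD1) (is_ev_copula_swap _ _ eD2).
split=> [[/h1//]|D12]; split; first exact/h1.
by apply/h2 => u v u01 v01; exact: D12.
Qed.

End ev_copulas.

(** * Random vectors with a copula as distribution function *)

Section measures_on_the_line.
Context {R : realType}.

(* [R] and [measurableTypeR R] carry the same sigma-algebra under different
   displays; this identity map relates measures on the two. *)
Definition idTR : measurableTypeR R -> R := idfun.

HB.instance Definition _ :=
  @isMeasurableFun.Build _ _ _ _ idTR (@measurable_id _ _ setT).

Lemma measurable_ray_generated :
  @measurable _ R = <<s [set A | exists x : R, A = `]-oo, x]%classic] >>.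
Proof.
apply/seteqP; split => A.
- apply: smallest_sub; first exact: smallest_sigma_algebra.
  move=> _ [[a b] _ <-] /=.
  rewrite (_ : `]a, b]%classic = `]-oo, b]%classic `\` `]-oo, a]%classic).
    by apply: (@measurableD _ (g_sigma_algebraType _));
      apply: sub_sigma_algebra; eexists; reflexivity.
  by rewrite -[RHS]setCK setCD setCitvl setUC -[LHS]setCK setCitv.
- apply: smallest_sub; first exact: sigma_algebra_measurable.
  by move=> _ [x ->]; exact: measurable_itv.
Qed.

(** The rays are stable under intersection, generate the Borel sets and exhaust the line with finite
    measure. *)
Lemma measure_eq_rays (m1 m2 : {measure set R -> \bar R}) :
  (forall x : R, m1 `]-oo, x]%classic = m2 `]-oo, x]%classic) ->
  (forall x : R, (m1 `]-oo, x]%classic < +oo)%E) ->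
  forall A, measurable A -> m1 A = m2 A.
Proof.
move=> m12 m1oo A mA.
apply: (measure_unique [set A | exists x : R, A = `]-oo, x]%classic]
  (fun n : nat => `]-oo, n%:R]%classic)) => //.
- exact: measurable_ray_generated.
- move=> _ _ [x ->] [y ->]; exists (Num.min x y).
  by apply/seteqP; split=> z /=; rewrite !in_itv/= le_min => /andP.
- by move=> n; exists n%:R.
- apply/seteqP; split=> // x _; exists (Num.bound x) => //=.
  rewrite in_itv/=; apply: le_trans (ler_norm x) _.
  by have := archi_boundP (normr_ge0 x); rewrite /Num.bound normr_id => /ltW.
- by move=> _ [x ->].
Qed.

(** The distribution function of the uniform law; clamping both arguments also extends a copula to a
    distribution function on the plane. *)
Definition clamp01 (x : R) : R := Num.max 0 (Num.min x 1).

Lemma clamp01_in x : clamp01 x \in `[0, 1].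
Proof.
by rewrite in_itv/= le_max lexx/= ge_max ler01 ge_min lexx orbT.
Qed.

Lemma clamp01_le0 x : x <= 0 -> clamp01 x = 0.
Proof. by move=> x0; rewrite /clamp01 min_l ?max_l// (le_trans x0). Qed.

Lemma clamp01_ge1 x : 1 <= x -> clamp01 x = 1.
Proof. by move=> x1; rewrite /clamp01 min_r// max_r. Qed.

Lemma clamp01_id x : x \in `[0, 1] -> clamp01 x = x.
Proof. by rewrite in_itv/= => /andP[? ?]; rewrite /clamp01 min_l// max_r. Qed.

Local Notation mu := (@lebesgue_measure R).

Definition uniform01 : set R -> \bar R :=
  distribution (uniform_prob (@ltr01 R)) idTR.

HB.instance Definition _ := Measure.on uniform01.

Lemma integral_uniform01 (f : R -> R) (B : set R) :
  measurable_fun setT f -> (forall x, 0 <= f x) -> measurable B ->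
  (\int[uniform01]_(x in B) (f x)%:E =
   \int[mu]_(x in B `&` `]0%R, 1%R[) (f x)%:E)%E.
Proof.
move=> mf f0 mB.
have mfE : measurable_fun setT (EFin \o f) by exact/measurable_EFinP.
rewrite /uniform01 ge0_integral_pushforward//; last 2 first.
- exact: measurable_funTS.
- by move=> x _; rewrite lee_fin.
rewrite integral_mkcond integral_uniform; last 2 first.
- exact/(measurable_restrictT _ _).1/measurable_funTS.
- by move=> x; apply: erestrict_ge0 => y _; rewrite lee_fin.
rewrite subr0 invr1 mul1e integral_itv_bndoo; last first.
  exact/measurable_funTS/(measurable_restrictT _ _).1/measurable_funTS.
by rewrite setIC [RHS]integral_mkcondr.
Qed.

Lemma uniform01E (B : set R) : measurable B ->
  uniform01 B = mu (B `&` `]0%R, 1%R[).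
Proof.
move=> mB; rewrite -[LHS]mul1e -integral_cst// integral_uniform01//.
by rewrite integral_cst ?mul1e//; exact: measurableI.
Qed.

(** [b] tells whether the right endpoint is excluded, which neither Lebesgue measure nor the
    integrals detect. *)
Lemma ray_setI01 x : exists b, `]-oo, x]%classic `&` `]0, 1[%classic =
  [set` Interval (BRight 0) (BSide b (clamp01 x))].
Proof.
have [x0|x0] := leP x 0.
  exists true; rewrite clamp01_le0// set_itvoo0.
  apply/seteqP; split => // t [] /=; rewrite !in_itv/= => tx /andP[t0 _].
  by have := lt_le_trans t0 (le_trans tx x0); rewrite ltxx.
have [x1|x1] := leP 1 x.
  exists true; rewrite clamp01_ge1//.
  apply/seteqP; split => t /=; rewrite !in_itv/=; first by case.
  by move=> /andP[t0 t1]; rewrite t0 t1 (le_trans (ltW t1)).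
exists false; rewrite clamp01_id; last by rewrite in_itv/= !ltW.
apply/seteqP; split => t /=; rewrite !in_itv/=.
  by move=> [tx /andP[t0 t1]]; rewrite t0.
by move=> /andP[t0 tx]; rewrite t0 tx (le_lt_trans tx).
Qed.

Lemma uniform01_ray x : uniform01 `]-oo, x]%classic = (clamp01 x)%:E.
Proof.
rewrite uniform01E; last exact: measurable_itv.
have [b ->] := ray_setI01 x.
have := clamp01_in x; rewrite in_itv/= => /andP[x0 _].
rewrite lebesgue_measure_itv/= lte_fin -EFinB subr0.
case: ifPn => //; rewrite -leNgt => x0'; congr EFin.
by apply/eqP; rewrite eq_le x0.
Qed.

End measures_on_the_line.

Section copula_vectors.
Context {R : realType} {d} {T : measurableType d} {P : probability T R}.
Implicit Types (U V : {RV P >-> R}) (C : R -> R -> R).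
Local Notation mu := (@lebesgue_measure R).

Lemma measurable_RV_preimage U (B : set R) : measurable B ->
  measurable (U @^-1` B).
Proof.
by move=> mB; rewrite -[X in measurable X]setTI; exact: measurable_funPT.
Qed.

Lemma probability_setI_full (A B : set T) : measurable A -> measurable B ->
  P B = 1%E -> P (A `&` B) = P A.
Proof.
move=> mA mB PB; apply/eqP; rewrite eq_le; apply/andP; split.
  by apply: le_measure; rewrite ?inE//; exact: measurableI.
have PC : P (~` B) = 0%E by rewrite probability_setC// PB subee.
rewrite -[leRHS]adde0 -PC; apply: le_trans (measureU2 _ _ _) => //.
- apply: le_measure; rewrite ?inE//.
  + by apply: measurableU; [exact: measurableI|exact: measurableC].
  + by move=> x Ax; have [Bx|Bx] := pselect (B x); [left|right].
- exact: measurableI.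
- exact: measurableC.
Qed.

Lemma joint_cdfC U V x y : joint_cdf V U y x = joint_cdf U V x y.
Proof. by rewrite /joint_cdf setIC. Qed.

Lemma has_joint_cdf_swap U V C : has_joint_cdf U V C ->
  has_joint_cdf V U (fun u v => C v u).
Proof. by move=> h u v u01 v01; rewrite joint_cdfC h. Qed.

Lemma le_joint_cdf U V x x' y y' : x <= x' -> y <= y' ->
  (joint_cdf U V x y <= joint_cdf U V x' y')%E.
Proof.
move=> xx yy; apply: le_measure; rewrite ?inE.
- by apply: measurableI; apply: measurable_RV_preimage; exact: measurable_itv.
- by apply: measurableI; apply: measurable_RV_preimage; exact: measurable_itv.
- by apply: setISS => t; apply: subset_itvl; rewrite bnd_simp.
Qed.

Lemma joint_cdf11 U V C : is_copula C -> has_joint_cdf U V C ->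
  joint_cdf U V 1 1 = 1%E.
Proof.
move=> [_ _ C1 _] hC.
have o01 : (1 : R) \in `[0, 1] by rewrite in_itv/= ler01 lexx.
by rewrite hC//; have [->] := C1 _ o01.
Qed.

(** Since [C 1 1 = 1], the event that [V] is at most [y] has probability one. *)
Lemma joint_cdf_ge1 U V C x y : is_copula C -> has_joint_cdf U V C -> 1 <= y ->
  joint_cdf U V x y = cdf U x.
Proof.
move=> cC hC y1; rewrite /joint_cdf probability_setI_full//.
- by apply: measurable_RV_preimage; exact: measurable_itv.
- by apply: measurable_RV_preimage; exact: measurable_itv.
- apply/eqP; rewrite eq_le probability_le1/=; last first.
    by apply: measurable_RV_preimage; exact: measurable_itv.
  rewrite -(joint_cdf11 U V C cC hC); apply: le_measure; rewrite ?inE.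
  + by apply: measurableI; apply: measurable_RV_preimage; exact: measurable_itv.
  + by apply: measurable_RV_preimage; exact: measurable_itv.
  + by move=> t [_]; apply: subset_itvl; rewrite bnd_simp.
Qed.

Lemma joint_cdf_le0 U V C x y : is_copula C -> has_joint_cdf U V C -> y <= 0 ->
  joint_cdf U V x y = 0%E.
Proof.
move=> cC hC y0; apply/eqP; rewrite eq_le measure_ge0 andbT.
have [_ C0 _ _] := cC.
have o01 : (1 : R) \in `[0, 1] by rewrite in_itv/= ler01 lexx.
have z01 : (0 : R) \in `[0, 1] by rewrite in_itv/= ler01 lexx.
have -> : 0%E = joint_cdf U V 1 0 by rewrite hC//; have [-> _] := C0 _ o01.
have [x1|x1] := leP x 1; first exact: le_joint_cdf.
(* Beyond 1 the first argument no longer matters, by [joint_cdf_ge1] with [U] and [V] exchanged. *)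
suff <- : joint_cdf U V x 0 = joint_cdf U V 1 0 by exact: le_joint_cdf.
rewrite -!(joint_cdfC U V).
have cC' := is_copula_swap _ cC; have hC' := has_joint_cdf_swap _ _ _ hC.
by rewrite !(joint_cdf_ge1 V U _ _ _ cC' hC')// ltW.
Qed.

Lemma joint_cdf_clampr U V C x y : is_copula C -> has_joint_cdf U V C ->
  joint_cdf U V x y = joint_cdf U V x (clamp01 y).
Proof.
move=> cC hC; have [y0|y0] := leP y 0.
  by rewrite (clamp01_le0 _ y0) !(joint_cdf_le0 U V C)//.
have [y1|y1] := leP 1 y.
  by rewrite (clamp01_ge1 _ y1) !(joint_cdf_ge1 U V C)//.
by rewrite clamp01_id// in_itv/= !ltW.
Qed.

Lemma joint_cdf_clamp U V C x y : is_copula C -> has_joint_cdf U V C ->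
  joint_cdf U V x y = (C (clamp01 x) (clamp01 y))%:E.
Proof.
move=> cC hC; rewrite (joint_cdf_clampr U V C)// -joint_cdfC.
rewrite (joint_cdf_clampr V U (fun u v => C v u))//; last 2 first.
- exact: is_copula_swap.
- exact: has_joint_cdf_swap.
by rewrite joint_cdfC hC// clamp01_in.
Qed.

Lemma copula_cdf U V C x : is_copula C -> has_joint_cdf U V C ->
  cdf U x = (clamp01 x)%:E.
Proof.
move=> cC hC; rewrite -(joint_cdf_ge1 U V C x 1)// (joint_cdf_clamp U V C)//.
have [_ _ C1 _] := cC; rewrite (clamp01_ge1 1)//.
by have [-> _] := C1 _ (clamp01_in x).
Qed.

Lemma copula_law U V C (B : set R) : is_copula C -> has_joint_cdf U V C ->
  measurable B -> distribution P U B = uniform01 B.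
Proof.
move=> cC hC; apply: measure_eq_rays => x.
  exact: etrans (copula_cdf U V C x cC hC) (esym (uniform01_ray x)).
by rewrite (le_lt_trans (probability_le1 _ _)) ?ltry.
Qed.

(** For [t] in (0, 1), [t <= clamp01 x] amounts to [t <= x]. *)
Lemma copula_quantile U V C t : is_copula C -> has_joint_cdf U V C ->
  t \in `]0, 1[ -> quantile U t = t.
Proof.
move=> cC hC t01; have t01' := subset_itv_oo_cc t01.
rewrite /quantile (_ : [set x | _] = `[t, +oo[%classic) ?inf_itv ?bnd_simp//.
apply/seteqP; split => x /=;
  rewrite (copula_cdf U V C)// lee_fin in_itv/= andbT.
  move=> tx; rewrite leNgt; apply/negP => xt; move: tx.
  rewrite leNgt => /negP; apply; move: t01; rewrite in_itv/= => /andP[t0 t1].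
  by rewrite gt_max t0 gt_min xt.
move=> tx; move: t01; rewrite in_itv/= => /andP[t0 t1].
by rewrite le_max le_min tx (ltW t1) orbT.
Qed.

End copula_vectors.

(** * Measures given by a density *)

Section density_measures.
Context d (T : measurableType d) {R : realType}.
Variable mu : {measure set T -> \bar R}.
Variables (f : T -> \bar R) (mf : measurable_fun setT f).
Hypothesis f0 : forall x, (0 <= f x)%E.

(** The two proofs are arguments so that the measure structure below can be inferred from the
    term. *)
Definition density_measure of measurable_fun setT f & forall x, (0 <= f x)%E :=
  fun A : set T => (\int[mu]_(x in A) f x)%E.

Local Notation nu := (density_measure mf f0).

Let nu0 : nu set0 = 0%E. Proof. exact: integral_set0. Qed.

Let nu_ge0 A : (0 <= nu A)%E. Proof. exact: integral_ge0. Qed.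

Let nu_sigma_additive : semi_sigma_additive nu.
Proof. exact: semi_sigma_additive_nng_induced. Qed.

HB.instance Definition _ := isMeasure.Build _ _ _ nu
  nu0 nu_ge0 nu_sigma_additive.

End density_measures.
Arguments density_measure {d T R} mu {f} _ _ _.

(** * Conditional distribution functions as slopes of the copula *)

Section conditional_cdf.
Context {R : realType} {d} {T : measurableType d} {P : probability T R}.
Implicit Types (U V : {RV P >-> R}) (C : R -> R -> R) (m : R -> R).
Local Notation mu := (@lebesgue_measure R).
Local Notation I01 := (`]0, 1[%classic : set R).

Definition restrict01 m (x : R) : R := if 0 < x < 1 then m x else 0.

Lemma restrict01E m x : x \in `]0, 1[ -> restrict01 m x = m x.
Proof. by rewrite in_itv/= /restrict01 => ->. Qed.

Lemma restrict01_bounds F m x : supergradient F m -> 0 <= restrict01 m x <= 1.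
Proof.
move=> Fm; rewrite /restrict01; case: ifPn => [x01|_]; last first.
  by rewrite lexx ler01.
by have [] := Fm x; rewrite ?in_itv.
Qed.

Lemma measurable_restrict01 F m : supergradient F m ->
  measurable_fun setT (restrict01 m).
Proof.
move=> Fm; rewrite (_ : restrict01 m = m \_ I01).
  apply/(measurable_restrictT _ _).1 => //.
  exact: noninc01_measurable (supergradient_nonincreasing _ _ Fm).
by apply/funext => x; rewrite patchE /restrict01 mem_setE in_itv.
Qed.

Lemma integral_uniform01_ray F m x :
  nondecreasing_lip01 F -> F 0 = 0 -> supergradient F m ->
  (\int[uniform01]_(t in `]-oo, x]) (restrict01 m t)%:E = (F (clamp01 x))%:E)%E.
Proof.
move=> lF F0 Fm; have mM := measurable_restrict01 _ _ Fm.
rewrite integral_uniform01//; last first.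
  by move=> t; have /andP[] := restrict01_bounds _ _ t Fm.
have [b ->] := ray_setI01 x.
rewrite integral_itv_bndoo; last exact/measurable_funTS/measurable_EFinP.
have := clamp01_in x; rewrite in_itv/= => x01.
have -> : F (clamp01 x) = F (clamp01 x) - F 0 by rewrite F0 subr0.
rewrite -(supergradient_integral F m)//.
apply: eq_integral => t; rewrite inE/= in_itv/= => /andP[t0 tx].
rewrite restrict01E// in_itv/= t0.
by case/andP: x01 => _; exact: lt_le_trans.
Qed.

(** Both sides of the defining identity are finite measures in [B]: one with density [restrict01 m]
    for the uniform law, the other the image under [U] of [P] restricted to [V <= y]. They agree on
    rays. *)
Lemma slope_is_cond_cdf U V C y m : is_copula C -> has_joint_cdf U V C ->
  supergradient (C ^~ (clamp01 y)) m -> is_cond_cdf V U y (restrict01 m).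
Proof.
move=> cC hC Cm; have mM := measurable_restrict01 _ _ Cm.
have M0 t : 0 <= restrict01 m t by have /andP[] := restrict01_bounds _ _ t Cm.
have M1 t : restrict01 m t <= 1 by have /andP[] := restrict01_bounds _ _ t Cm.
split.
  apply: measurable_bounded_integrable => //.
    by rewrite (le_lt_trans (probability_le1 _ _)) ?ltry.
  exists 1; split => // r r1 x _ /=.
  by rewrite ger0_norm// (le_trans (M1 x))// ltW.
move=> B mB.
have mV : measurable (V @^-1` `]-oo, y]).
  by apply: measurable_RV_preimage; exact: measurable_itv.
transitivity (\int[uniform01]_(x in B) (restrict01 m x)%:E)%E.
  by apply: eq_measure_integral => A mA _; exact: copula_law cC hC mA.
have mE : measurable_fun setT (EFin \o restrict01 m) by exact/measurable_EFinP.
have E0 t : (0 <= (EFin \o restrict01 m) t)%E by rewrite lee_fin.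
have [_ C0 _ _] := cC.
have rays x : density_measure uniform01 mE E0 `]-oo, x]%classic =
    joint_cdf U V x y.
  rewrite (joint_cdf_clamp U V C)//.
  apply: (integral_uniform01_ray (C ^~ (clamp01 y))) => //.
    exact: copula_lip01 (clamp01_in y).
  by have [_ ->] := C0 _ (clamp01_in y).
suff: density_measure uniform01 mE E0 B = pushforward (mrestr P mV) U B by [].
move: B mB; apply: measure_eq_rays => x; first exact: rays.
apply: (@le_lt_trans _ _ (joint_cdf U V x y)); first by rewrite -(rays x).
rewrite (le_lt_trans (probability_le1 _ _)) ?ltry//.
apply: measurableI => //; apply: measurable_RV_preimage.
exact: measurable_itv.
Qed.

(** The version picked by [get] has the same integrals as [restrict01 m] over all Borel sets, so
    they agree almost everywhere for the law of [U], which is uniform; on (0, 1) the quantile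
    function is the identity. *)
Lemma cond_cdf_slope U V C y : is_copula C -> has_joint_cdf U V C ->
  (exists m, supergradient (C ^~ (clamp01 y)) m) ->
  ae_slope (C ^~ (clamp01 y)) (cond_cdf V U y \o quantile U).
Proof.
move=> cC hC [m Cm]; have cM := slope_is_cond_cdf _ _ _ _ _ cC hC Cm.
have [gint gE] : is_cond_cdf V U y (cond_cdf V U y).
  by apply: (@getPex _ [set g | is_cond_cdf V U y g]); exists (restrict01 m).
have mg : measurable_fun setT (cond_cdf V U y).
  by apply/measurable_EFinP; exact: measurable_int gint.
have [_ C0 _ _] := cC.
exists m; split => //.
- exact: copula_lip01 (clamp01_in y).
- by have [_ ->] := C0 _ (clamp01_in y).
- apply: (eq_measurable_fun (cond_cdf V U y)); last exact: measurable_funTS.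
  by move=> t; rewrite inE/= => t01; rewrite (copula_quantile U V C).
- have [N [mN N0 subN]] : ae_eq (distribution P U) setT
      (EFin \o cond_cdf V U y) (EFin \o restrict01 m).
    apply: integral_ae_eq => //.
      by apply/measurable_EFinP; exact: measurable_restrict01 Cm.
    by move=> E _ mE; rewrite gE// cM.2.
  (* The law of [U] controls [N] only inside (0, 1); outside, [N] may have positive Lebesgue
     measure. *)
  exists (N `&` I01); split.
  + by apply: measurableI => //; exact: measurable_itv.
  + rewrite -N0; apply/esym.
    exact: etrans (copula_law _ _ _ _ cC hC mN) (uniform01E _ mN).
  + move=> t /not_implyP[t01 /=]; rewrite (copula_quantile U V C)// => gm.
    split => //; apply: subN => /= /(_ I)[gM]; apply: gm.
    by rewrite gM restrict01E.
Qed.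

End conditional_cdf.

(** * The Schur order of conditional distributions *)

Section conditional_schur_order.
Context {R : realType} {d d'} {T : measurableType d} {T' : measurableType d'}.
Context {P : probability T R} {P' : probability T' R}.

Lemma cond_schur_le_le_lo (U V : {RV P >-> R}) (U' V' : {RV P' >-> R})
    (A1 A2 : R -> R) (D1 D2 : R -> R -> R) :
  is_ev_copula A1 D1 -> is_ev_copula A2 D2 ->
  has_joint_cdf U V D1 -> has_joint_cdf U' V' D2 ->
  cond_schur_le V U V' U' <-> le_lo D1 D2.
Proof.
move=> eD1 eD2 h1 h2; have [cD1 _ _] := eD1; have [cD2 _ _] := eD2.
have [[_ _ D11 _] [_ _ D21 _]] := (cD1, cD2).
have main y : schur_le (cond_cdf V U y \o quantile U)
                       (cond_cdf V' U' y \o quantile U') <->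
    {in `]0, 1[, forall x, D1 x (clamp01 y) <= D2 x (clamp01 y)}.
  apply: (schur_le_slope (D1 ^~ (clamp01 y)) (D2 ^~ (clamp01 y))).
  - apply: cond_cdf_slope => //.
    by apply: (ev_copula_supergradient A1) => //; exact: clamp01_in.
  - apply: cond_cdf_slope => //.
    by apply: (ev_copula_supergradient A2) => //; exact: clamp01_in.
  - by have [_ ->] := D11 _ (clamp01_in y); have [_ ->] := D21 _ (clamp01_in y).
split=> [[_ D12]|D12].
  apply: le_lo_interior => // u v u01 v01.
  have /main := D12 v; rewrite clamp01_id; last exact: subset_itv_oo_cc.
  exact.
(* Equality in distribution holds because [V] and [V'] are both uniform, by [copula_law] for the
   transposed copulas. *)
split=> [B mB|y].
  rewrite (copula_law V U (fun u v => D1 v u))//; last 2 first.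
  - exact: is_copula_swap.
  - exact: has_joint_cdf_swap.
  rewrite (copula_law V' U' (fun u v => D2 v u))//.
  - exact: is_copula_swap.
  - exact: has_joint_cdf_swap.
by apply/main => x x01; apply: D12; [exact: subset_itv_oo_cc|exact: clamp01_in].
Qed.

End conditional_schur_order.

Theorem theorem3p4 (R : realType) (A1 A2 : R -> R) (D1 D2 : R -> R -> R)
    (d d' : measure_display) (T : measurableType d) (T' : measurableType d')
    (P : probability T R) (P' : probability T' R)
    (U V : {RV P >-> R}) (U' V' : {RV P' >-> R})
    (hD1 : is_ev_copula A1 D1) (hD2 : is_ev_copula A2 D2)
    (hUV : has_joint_cdf U V D1) (hUV' : has_joint_cdf U' V' D2) :
  [<-> {in `]0, 1[, forall t : R, A1 t >= A2 t};
       le_lo D1 D2;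
       le_dS D1 D2;
       cond_schur_le V U V' U';
       cond_schur_le U V U' V'].
Proof.
have h1 := pickands_le_lo _ _ _ _ hD1 hD2.
have h3 := le_dS_le_lo _ _ _ _ hD1 hD2.
have h4 := cond_schur_le_le_lo _ _ _ _ _ _ _ _ hD1 hD2 hUV hUV'.
have h5 : cond_schur_le U V U' V' <->
    le_lo (fun u v => D1 v u) (fun u v => D2 v u).
  exact: cond_schur_le_le_lo _ _ _ _ _ _ _ _ (is_ev_copula_swap _ _ hD1)
    (is_ev_copula_swap _ _ hD2) (has_joint_cdf_swap _ _ _ hUV)
    (has_joint_cdf_swap _ _ _ hUV').
tfae.
- by move/h1.
- by move/h3.
- by move/h3/h4.
- by move/h4 => D12; apply/h5 => u v u01 v01; exact: D12.
- by move/h5 => D12; apply/h1 => u v u01 v01; exact: D12.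
Qed.
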